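(* Fix $c\in\mathbb{N}_0$ and let $\mathcal{G}$ be a graph class of bounded treewidth. The following are equivalent: (a) $\mathcal{G}$ has bounded $c$-tree-partition-width, i.e. $\sup_{G\in\mathcal{G}}\mathrm{tpw}_c(G)<\infty$; (b) for some $d,\ell\in\mathbb{N}$, every graph in $\mathcal{G}$ has a $(c,d)$-disjointed $\ell$-partition; (c) for some $d,\ell\in\mathbb{N}$, every graph in $\mathcal{G}$ has a $(c,d)$-disjointed $\ell$-covering; (d) for some $\ell\in\mathbb{N}$ and some function $f:\mathbb{N}\to\mathbb{R}^+$, every graph in $\mathcal{G}$ has a $(c,f)$-disjointed $\ell$-partition; (e) for some $\ell\in\mathbb{N}$ and some function $f:\mathbb{N}\to\mathbb{R}^+$, every graph in $\mathcal{G}$ has a $(c,f)$-disjointed $\ell$-covering.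
   Context: Graphs are finite, simple and undirected; $\mathrm{tw}$ denotes treewidth; a graph class is a set of graphs closed under isomorphism. For graphs $G,H$, an $H$-partition of $G$ is a partition $(V_x : x\in V(H))$ of $V(G)$ indexed by the vertices of $H$ such that for every edge $vw$ of $G$ with $v\in V_x$ and $w\in V_y$, either $x=y$ or $xy\in E(H)$; its width is $\max_{x}|V_x|$. For $c\in\mathbb{N}_0$, $\mathrm{tpw}_c(G)$ is the minimum width of an $H$-partition of $G$ over all graphs $H$ with $\mathrm{tw}(H)\le c$. For a set $B\subseteq V(G)$, $N_G(B)$ is the set of vertices of $G$ adjacent to some vertex of $B$ (so $N_G(\emptyset)=\emptyset$). An $\ell$-covering of $G$ is a set $\beta\subseteq 2^{V(G)}$ with $|B|\le \ell$ for all $B\in\beta$ and $\bigcup_{B\in\beta}B=V(G)$; it is an $\ell$-partition if its members are pairwise disjoint. For $c\in\mathbb{N}_0$ and $d\ge 0$, an $\ell$-covering $\beta$ is $(c,d)$-disjointed if for every $c$-tuple $(B_1,\dots,B_c)\in\beta^c$ and every connected component $X$ of $G-(B_1\cup\dots\cup B_c)$ there is $Q\subseteq V(X)$ with $|Q|\le d$ such that for every connected component $Y$ of $X-Q$ there is $i\in\{1,\dots,c\}$ with $V(Y)\cap N_G(B_i')=\emptyset$, where $B_i':=B_i\setminus(B_1\cup\dots\cup B_{i-1})$. For $t\in\mathbb{N}$, $\beta[t]:=\{\bigcup\mathcal{B} : \mathcal{B}\subseteq\beta, |\mathcal{B}|\le t\}$. For $f:\mathbb{N}\to\mathbb{R}^+$,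 $\beta$ is $(c,f)$-disjointed if $\beta[t]$ is $(c,f(t))$-disjointed for every $t\in\mathbb{N}$. *)

(* Defs.v *)
From HB Require Import structures.
From Stdlib Require Import Reals.
From mathcomp Require Import all_boot.

Set Implicit Arguments.
Unset Strict Implicit.
Unset Printing Implicit Defensive.

Record sgraph := SGraph {
  vert :> finType;
  adj : rel vert;
  adj_sym : symmetric adj;
  adj_irr : irreflexive adj }.

Arguments adj {s}.

Definition graph_iso (G H : sgraph) (f : G -> H) :=
  bijective f /\ forall u v : G, adj u v = adj (f u) (f v).

Definition iso_closed (C : sgraph -> Prop) :=
  forall (G H : sgraph) (f : G -> H), graph_iso f -> C G -> C H.

Definition connected_graph (G : sgraph) := forall x y : G, connect (@adj G) x y.
Definition acyclic_graph (G : sgraph) :=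
  forall cyc : seq G, 3 <= size cyc -> ~ ucycle (@adj G) cyc.
Definition is_tree (T : sgraph) := [/\ 0 < #|T|, connected_graph T & acyclic_graph T].

Definition tree_decomposition (G T : sgraph) (bag : T -> {set G}) :=
  [/\ is_tree T,
      forall v : G, exists t : T, v \in bag t,
      forall u v : G, adj u v -> exists t : T, (u \in bag t) && (v \in bag t) &
      forall (v : G) (s t : T), v \in bag s -> v \in bag t ->
        connect [rel a b : T | [&& adj a b, v \in bag a & v \in bag b]] s t].

Definition tw_le (G : sgraph) (k : nat) :=
  exists (T : sgraph) (bag : T -> {set G}),
    tree_decomposition bag /\ forall t : T, #|bag t| <= k.+1.

(* H-partitions: the part V_x is the fibre of p over x. *)
Definition H_partition (G H : sgraph) (p : G -> H) :=
  forall u v : G, adj u v -> (p u == p v) || adj (p u) (p v).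

Definition part_width_le (G H : sgraph) (p : G -> H) (w : nat) :=
  forall x : H, #|[set v | p v == x]| <= w.

Definition tpw_le (c : nat) (G : sgraph) (w : nat) :=
  exists (H : sgraph) (p : G -> H), [/\ tw_le H c, H_partition p & part_width_le p w].

Definition nbh (G : sgraph) (B : {set G}) : {set G} :=
  [set v | [exists u in B, adj u v]].

Definition induced_rel (G : sgraph) (A : {set G}) : rel G :=
  [rel u v | [&& u \in A, v \in A & adj u v]].

Definition component (G : sgraph) (A X : {set G}) :=
  exists2 x, x \in A & X = [set y in A | connect (induced_rel A) x y].

Definition lcovering (G : sgraph) (l : nat) (beta : {set {set G}}) :=
  (forall B, B \in beta -> #|B| <= l) /\ \bigcup_(B in beta) B = [set: G].

Definition lpartition (G : sgraph) (l : nat) (beta : {set {set G}}) :=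
  lcovering l beta /\
  (forall A B, A \in beta -> B \in beta -> A != B -> [disjoint A & B]).

Definition disjointed (G : sgraph) (c : nat) (d : R) (beta : {set {set G}}) :=
  forall Bs : 'I_c -> {set G}, (forall i, Bs i \in beta) ->
  forall X : {set G}, component (~: \bigcup_(i < c) Bs i) X ->
  exists Q : {set G}, [/\ Q \subset X, Rle (INR #|Q|) d &
    forall Y : {set G}, component (X :\: Q) Y ->
      exists i : 'I_c,
        Y :&: nbh (Bs i :\: \bigcup_(j < c | (j < i)%N) Bs j) = set0].

Definition unions_upto (G : sgraph) (beta : {set {set G}}) (t : nat) : {set {set G}} :=
  [set \bigcup_(B in S) B | S : {set {set G}} in [set S0 : {set {set G}} in powerset beta | #|S0| <= t]].

(* (c,f)-disjointedness, f : N -> R^+ (N = positive integers) *)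
Definition f_disjointed (G : sgraph) (c : nat) (f : nat -> R) (beta : {set {set G}}) :=
  forall t, 0 < t -> disjointed c (f t) (unions_upto beta t).

Definition pos_fun (f : nat -> R) := forall t, 0 < t -> Rlt 0 (f t).

(* Main.v *)
Require Import Defs.
From HB Require Import structures.
From Stdlib Require Import Reals.
From mathcomp Require Import all_boot.

Set Implicit Arguments.
Unset Strict Implicit.
Unset Printing Implicit Defensive.

(** A tree decomposition is rooted and numbered so that [par j < j]
    except at the root; it then suffices that a vertex lying in two bags also
    lies in the bag at the parent of the later one.

    (a) => (d): In a graph [H] of treewidth at most [c], one bag separates any
    [c] vertices in the required sense, so the singletons are
    [(c, c + 1)]-disjointed. Disjointedness passes to unions of at most [t]
    members, and it pulls back along an [H]-partition.

    (c) => (a): Parts are removed one at a time from a component [Y] of the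
    vertices not yet covered. The invariant is that the covered neighbours of
    [Y] are covered by [c] small sets [h a], each a union of boundedly many members
    of the covering and each responsible for a single part, where these [c] parts
    share a bag. Disjointedness, applied to the [h a], splits [Y] by a bounded
    set into pieces that miss one of them; enlarging that set so that each
    piece attaches to boundedly many of its vertices, a union of members
    covering the attachment replaces the missed one. *)

(** * Connected sets and components *)

Section Components.
Variable G : sgraph.
Implicit Types A X Y : {set G}.

Definition connected_set X := {in X &, forall x y, connect (induced_rel X) x y}.

Lemma induced_relE A u v :
  induced_rel A u v = [&& u \in A, v \in A & adj u v].
Proof. by []. Qed.

Lemma induced_rel_sym A : symmetric (induced_rel A).
Proof. by move=> x y; rewrite !induced_relE adj_sym andbCA. Qed.

Lemma connect_induced_sym A : connect_sym (induced_rel A).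
Proof. by exact/sym_connect_sym/induced_rel_sym. Qed.

Lemma connect_closed (V : finType) (r : rel V) (P : pred V) x y :
  (forall a b, P a -> r a b -> P b) -> P x -> connect r x y -> P y.
Proof.
move=> Pr Px /connectP[p]; elim: p x Px => [|z p IH] x Px /= => [_ -> //|].
by case/andP=> xz; apply: IH; apply: Pr xz.
Qed.

Definition components A :=
  [set [set y in A | connect (induced_rel A) x y] | x in A].

Lemma componentP A X : reflect (component A X) (X \in components A).
Proof. exact: imsetP. Qed.

Lemma component_neq0 A X : component A X -> X != set0.
Proof.
by case=> x xA ->; apply/set0Pn; exists x; rewrite inE xA connect0.
Qed.

Lemma component_sub A X : component A X -> X \subset A.
Proof. by case=> x xA ->; apply/subsetP => y; rewrite inE => /andP[]. Qed.

Lemma component_closed A X x y :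
  component A X -> x \in X -> y \in A -> adj x y -> y \in X.
Proof.
case=> z zA ->; rewrite !inE => /andP[xA zx] yA xy; rewrite yA.
by apply: connect_trans zx (connect1 _); rewrite induced_relE xA yA.
Qed.

Lemma component_connected A X : component A X -> connected_set X.
Proof.
move=> cX; have zX := component_closed cX; case: (cX) => z zA eX.
suff Xz x : x \in X -> connect (induced_rel X) z x.
  move=> x y xX yX; apply: connect_trans (Xz y yX).
  by rewrite connect_induced_sym Xz.
rewrite {1}eX inE => /andP[_ zx].
have: (x \in X) && connect (induced_rel X) z x; last by case/andP.
apply: (connect_closed (P := fun x => (x \in X) && connect (induced_rel X) z x)
          _ _ zx) => [a b /andP[aX za] /and3P[_ bA ab]|].
  have bX := zX _ _ aX bA ab; rewrite bX.
  by apply: connect_trans za (connect1 _); rewrite induced_relE aX bX.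
by rewrite connect0 andbT eX inE zA connect0.
Qed.

Lemma component_of A x : x \in A -> exists2 X, component A X & x \in X.
Proof.
move=> xA; exists [set y in A | connect (induced_rel A) x y]; first by exists x.
by rewrite inE xA connect0.
Qed.

Lemma component_absorb A X Y :
  component A X -> connected_set Y -> Y \subset A -> X :&: Y != set0 ->
  Y \subset X.
Proof.
move=> cX cY /subsetP sYA /set0Pn[x /setIP[xX xY]].
apply/subsetP=> y yY; apply: connect_closed (cY x y xY yY) => // a b aX.
by case/and3P=> _ /sYA bA; apply: component_closed bA.
Qed.

Lemma component_eq A X Y :
  component A X -> component A Y -> X :&: Y != set0 -> X = Y.
Proof.
move=> cX cY ne; apply/eqP; rewrite eqEsubset.
rewrite (component_absorb cY (component_connected cX) (component_sub cX)).
  exact: component_absorb (component_connected cY) (component_sub cY) ne.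
by rewrite setIC.
Qed.

Lemma connected_in_component A Y :
  connected_set Y -> Y != set0 -> Y \subset A ->
  exists2 X, component A X & Y \subset X.
Proof.
move=> cY /set0Pn[y yY] sYA.
have [X cX yX] := component_of (subsetP sYA y yY).
exists X => //; apply: component_absorb cX cY sYA _.
by apply/set0Pn; exists y; rewrite inE yX.
Qed.

Lemma connected_constant X (P : pred G) x y :
  connected_set X -> {in X &, forall a b, adj a b -> P a -> P b} ->
  x \in X -> y \in X -> P x -> P y.
Proof.
move=> cX Padj xX yX Px.
have: P y && (y \in X); last by case/andP.
apply: (connect_closed (P := fun y => P y && (y \in X)) _ _ (cX x y xX yX)).
  by move=> a b /andP[Pa aX] /and3P[_ bX ab]; rewrite bX (Padj a b).
by rewrite Px.
Qed.

Lemma mem_nbh (B : {set G}) v : reflect (exists2 u, u \in B & adj u v) (v \in nbh B).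
Proof.
rewrite inE; apply: (iffP existsP) => [[u /andP[]]|[u uB uv]]; first by exists u.
by exists u; rewrite uB.
Qed.

End Components.

(** An edge of [G] is either collapsed by [p] or sent to an edge of [H], so paths project to
    paths. *)
Lemma connected_imset (G H : sgraph) (p : G -> H) (Y : {set G}) :
  H_partition p -> connected_set Y -> connected_set (p @: Y).
Proof.
move=> pP cY _ _ /imsetP[x xY ->] /imsetP[y yY ->].
have: connect (induced_rel (p @: Y)) (p x) (p y) && (y \in Y); last by case/andP.
pose P z := connect (induced_rel (p @: Y)) (p x) (p z) && (z \in Y).
apply: (connect_closed (P := P) _ _ (cY x y xY yY)); rewrite /P;
  last by rewrite connect0.
move=> a b /andP[xa aY] /and3P[_ bY ab]; rewrite bY andbT.
case/orP: (pP a b ab) => [/eqP <- //|pab].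
by apply: connect_trans xa (connect1 _); rewrite induced_relE !imset_f.
Qed.

(** * Disjointedness of unions and of preimages *)

(** The version with a natural number as bound, in which all counting takes place; a real bound is
    rounded up. *)
Definition ndisjointed (G : sgraph) c (d : nat) (beta : {set {set G}}) :=
  forall Bs : 'I_c -> {set G}, (forall i, Bs i \in beta) ->
  forall X : {set G}, component (~: \bigcup_(i < c) Bs i) X ->
  exists Q : {set G}, [/\ Q \subset X, #|Q| <= d &
    forall Y : {set G}, component (X :\: Q) Y ->
      exists i : 'I_c,
        Y :&: nbh (Bs i :\: \bigcup_(j < c | (j < i)%N) Bs j) = set0].

Lemma ndisjointedP (G : sgraph) c d (beta : {set {set G}}) :
  ndisjointed c d beta -> disjointed c (INR d) beta.
Proof.
move=> db Bs bBs X cX; have [Q [sQ cQ QY]] := db Bs bBs X cX.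
by exists Q; split=> //; apply/le_INR/leP.
Qed.

Lemma disjointed_ub (G : sgraph) c (r : R) d (beta : {set {set G}}) :
  Rle r (INR d) -> disjointed c r beta -> ndisjointed c d beta.
Proof.
move=> rd db Bs bBs X cX; have [Q [sQ cQ QY]] := db Bs bBs X cX.
by exists Q; split=> //; apply/leP/INR_le; apply: Rle_trans cQ rd.
Qed.

Lemma disjointed_sub (G : sgraph) c r (beta gamma : {set {set G}}) :
  gamma \subset beta -> disjointed c r beta -> disjointed c r gamma.
Proof. by move=> /subsetP gb db Bs bBs; apply: db => i; apply: gb. Qed.

Lemma unions_uptoP (G : sgraph) (beta : {set {set G}}) t B :
  reflect (exists S : {set {set G}},
             [/\ S \subset beta, #|S| <= t & B = \bigcup_(A in S) A])
          (B \in unions_upto beta t).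
Proof.
apply: (iffP imsetP) => [[S]|[S [Sb St ->]]].
  by rewrite !inE => /andP[Sb St] ->; exists S.
by exists S; rewrite // !inE Sb.
Qed.

Lemma sub_unions_upto (G : sgraph) (beta : {set {set G}}) t :
  0 < t -> beta \subset unions_upto beta t.
Proof.
move=> t0; apply/subsetP=> B bB; apply/unions_uptoP; exists [set B].
by rewrite sub1set cards1 big_set1.
Qed.

(* Taking one member from each of the [c] unions gives at most [t ^ c] tuples;
   the union of the separators of all these tuples separates the unions. *)
Lemma ndisjointed_unions_upto (G : sgraph) c d (beta : {set {set G}}) t :
  ndisjointed c d beta -> ndisjointed c (t ^ c * d) (unions_upto beta t).
Proof.
move=> db Bs bBs X cX.
have exS i : exists S : {set {set G}},
    [/\ S \subset beta, #|S| <= t & Bs i = \bigcup_(A in S) A].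
  exact/unions_uptoP.
have [S SP] := fin_all_exists exS.
pose tuples := [set s : {ffun 'I_c -> {set G}} | [forall i, s i \in S i]].
(* [s i] lies in [Bs i], so [X] avoids the smaller union too and lies in one component of its
   complement. *)
have sX (s : {ffun 'I_c -> {set G}}) : s \in tuples ->
    X \subset ~: \bigcup_(i < c) s i.
  rewrite inE => /forallP sS; apply: subset_trans (component_sub cX) _.
  rewrite setCS; apply/bigcupsP=> i _.
  apply: (@subset_trans _ _ (Bs i)); last exact: bigcup_sup.
  have [_ _ ->] := SP i; apply/subsetP=> v vs; apply/bigcupP.
  by exists (s i).
(* Stated for connected sets: a component left by all the separators together need not be a
   component after removing just one of them. *)
have exQ (s : {ffun 'I_c -> {set G}}) : exists Q : {set G},
   s \in tuples -> #|Q| <= d /\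
   forall Y : {set G}, connected_set Y -> Y != set0 -> Y \subset X :\: Q ->
      exists i : 'I_c, Y :&: nbh (s i :\: \bigcup_(j < c | (j < i)%N) s j) = set0.
  have [sT|] := boolP (s \in tuples); last by exists set0.
  have [|X' cX' sXX'] := connected_in_component (A := ~: \bigcup_(i < c) s i)
     (component_connected cX) (component_neq0 cX); first exact: sX.
  have sb i : s i \in beta.
    have [/subsetP Sb _ _] := SP i; apply: Sb.
    by move: sT; rewrite inE => /forallP.
  have [Q [sQ cQ QY]] := db s sb X' cX'.
  exists Q => _; split=> // Y cY Y0 sYX.
  have sYX' : Y \subset X' :\: Q by apply: subset_trans sYX (setSD _ _).
  have [Y' cY' sYY'] := connected_in_component cY Y0 sYX'.
  have [i Yi] := QY Y' cY'; exists i; apply/eqP; rewrite -subset0.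
  by apply: subset_trans (setSI _ sYY') _; rewrite Yi.
have [Q QP] := fin_all_exists exQ.
exists (X :&: \bigcup_(s in tuples) Q s); split; first exact: subsetIl.
  apply: leq_trans (subset_leq_card (subsetIr _ _)) _.
  apply: (@leq_trans (\sum_(s in tuples) d)).
    apply: (@leq_trans (\sum_(s in tuples) #|Q s|)); last first.
      by apply: leq_sum => s sT; have [] := QP s sT.
    elim/big_rec2: _ => [|s A n _ IH]; first by rewrite cards0.
    by apply: leq_trans (leq_card_setU _ _) _; rewrite leq_add2l.
  rewrite sum_nat_const leq_mul2r; apply/orP; right.
  have -> : #|tuples| = #|family (fun i => mem (S i))|.
    by apply: eq_card => s; rewrite inE; apply: eq_forallb.
  have le_prod (e : seq 'I_c) : foldr muln 1 [seq #|S i| | i <- e] <= t ^ size e.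
    elim: e => [|i e IH] //=; rewrite expnS leq_mul //; by have [] := SP i.
  by rewrite card_family; apply: leq_trans (le_prod _) _; rewrite -cardE card_ord.
move=> Y cY.
have [/existsP[i /eqP ?]|/existsPn ne] := boolP [exists i : 'I_c,
   Y :&: nbh (Bs i :\: \bigcup_(j < c | (j < i)%N) Bs j) == set0].
  by exists i.
(* If [Y] meets all [c] neighbourhoods, the members containing the vertices responsible form a tuple
   whose own separator is contradicted by [Y]. *)
have exA (i : 'I_c) : exists A, A \in S i /\
   Y :&: nbh (A :\: \bigcup_(j < c | (j < i)%N) Bs j) != set0.
  have /set0Pn[y /setIP[yY /mem_nbh[u /setDP[uB uN] uy]]] := ne i.
  have [_ _ Bi] := SP i; move: uB; rewrite {1}Bi => /bigcupP[A AS uA].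
  exists A; split=> //; apply/set0Pn; exists y; rewrite inE yY.
  by apply/mem_nbh; exists u => //; rewrite inE uN.
have [s sP] := fin_all_exists exA.
have sT : finfun s \in tuples.
  by rewrite inE; apply/forallP=> i; rewrite ffunE; have [] := sP i.
have [_ QY] := QP _ sT.
have [|i] := QY Y (component_connected cY) (component_neq0 cY).
  apply: subset_trans (component_sub cY) _; apply/subsetP=> y.
  rewrite !inE => /andP[+ yX]; rewrite yX /= andbT; apply: contra => yQ.
  by apply/bigcupP; exists (finfun s).
have [_ /set0Pn[y /setIP[yY /mem_nbh[u /setDP[uA uN] uy]]]] := sP i.
rewrite ffunE => /setP/(_ y); rewrite !inE yY /=.
case/existsP; exists u; rewrite uy andbT !inE uA andbT.
apply: contra uN => /bigcupP[j ji]; rewrite ffunE => uj.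
apply/bigcupP; exists j => //; have [_ _ ->] := SP j.
by apply/bigcupP; exists (s j); rewrite //; have [] := sP j.
Qed.

Section Preimage.
Variables (G H : sgraph) (p : G -> H) (w : nat).
Hypotheses (pP : H_partition p) (pw : part_width_le p w).

Lemma card_preimset_le (S : {set H}) : #|p @^-1: S| <= w * #|S|.
Proof.
have -> : p @^-1: S = \bigcup_(x in S) [set v | p v == x].
  apply/setP=> v; rewrite inE; apply/idP/bigcupP => [pv|[x xS]].
    by exists (p v); rewrite ?inE.
  by rewrite inE => /eqP ->.
rewrite mulnC -sum_nat_const.
elim/big_rec2: _ => [|s n A _ IH]; first by rewrite cards0.
by apply: leq_trans (leq_card_setU _ _) _; rewrite leq_add.
Qed.

(** A component of [G] minus the preimages projects into a component of [H] minus the sets [S i];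
    the preimage of a separator of the latter separates the former. *)
Lemma ndisjointed_preimset c d (beta : {set {set H}}) :
  ndisjointed c d beta ->
  ndisjointed c (w * d) [set p @^-1: B | B : {set H} in beta].
Proof.
move=> db Bs bBs X cX.
have exS i : exists S, S \in beta /\ Bs i = p @^-1: S.
  by case/imsetP: (bBs i) => S; exists S.
have [S SP] := fin_all_exists exS.
have Bp (P : pred 'I_c) :
    \bigcup_(i < c | P i) Bs i = p @^-1: \bigcup_(i < c | P i) S i.
  apply/setP=> v; rewrite inE; apply/bigcupP/bigcupP => -[i Pi].
    by have [_ ->] := SP i; rewrite inE; exists i.
  by move=> vS; exists i => //; have [_ ->] := SP i; rewrite inE.
have [||X' cX' /subsetP sXX'] := connected_in_component
    (A := ~: \bigcup_(i < c) S i) (connected_imset pP (component_connected cX)).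
- have /set0Pn[x xX] := component_neq0 cX.
  by apply/set0Pn; exists (p x); apply: imset_f.
- apply/subsetP=> _ /imsetP[x /(subsetP (component_sub cX)) + ->].
  by rewrite Bp !inE.
have Sb i : S i \in beta by have [] := SP i.
have [Q [sQ cQ QY]] := db S Sb X' cX'.
exists (X :&: p @^-1: Q); split; first exact: subsetIl.
  apply: leq_trans (subset_leq_card (subsetIr _ _)) _.
  by apply: leq_trans (card_preimset_le Q) _; rewrite leq_mul2l cQ orbT.
move=> Y cY; have /subsetP sYX := component_sub cY.
have [||Y' cY' /subsetP sYY'] := connected_in_component
    (A := X' :\: Q) (connected_imset pP (component_connected cY)).
- have /set0Pn[x xX] := component_neq0 cY.
  by apply/set0Pn; exists (p x); apply: imset_f.
- apply/subsetP=> _ /imsetP[y /sYX + ->].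
  by rewrite !inE => /andP[+ yX]; rewrite yX /= => ->; apply/sXX'/imset_f.
have [i Yi] := QY Y' cY'; exists i; apply/eqP/set0Pn => -[y /setIP[yY]].
case/mem_nbh=> u; have [_ ->] := SP i; rewrite Bp !inE => /andP[uN uS] uy.
move/setP/(_ (p y)): Yi; rewrite !inE sYY' ?imset_f //=.
case/existsP; exists (p u); rewrite !inE uN uS /=.
(* An edge within one part is impossible: its end [y] would lie in the preimage of [S i], which [X]
   avoids. *)
case/orP: (pP uy) => // /eqP puy.
have := sYX _ yY; rewrite inE => /andP[_ /(subsetP (component_sub cX))].
by rewrite Bp !inE -puy => /bigcupP[]; exists i.
Qed.

End Preimage.

(** * Rooted tree decompositions *)

Section Ancestors.
Variable par : nat -> nat.
Hypothesis par_le : forall j, par j <= j.-1.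

(** [j] steps suffice, since each step decreases a positive number and [0] is fixed; the bound keeps
    the relation boolean. *)
Definition ancestor i j := i \in traject par j j.+1.

Lemma iter_par_le m j : iter m par j <= j - m.
Proof.
elim: m => [|m IH]; first by rewrite subn0.
rewrite iterS subnS; apply: leq_trans (par_le _) _.
by rewrite -!subn1 leq_sub2r.
Qed.

Lemma ancestorP i j : reflect (exists m, i = iter m par j) (ancestor i j).
Proof.
apply: (iffP trajectP) => [[m _ ->]|[m ->]]; first by exists m.
case: (ltnP m j.+1) => [mj|jm]; first by exists m.
exists j => //; move: (iter_par_le m j) (iter_par_le j j).
by rewrite subnn (eqP (ltnW jm)) !leqn0 => /eqP -> /eqP ->.
Qed.

Lemma ancestor_refl i : ancestor i i.
Proof. by apply/ancestorP; exists 0. Qed.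

Lemma ancestor_par j : ancestor (par j) j.
Proof. by apply/ancestorP; exists 1. Qed.

Lemma ancestor_trans j i m : ancestor i j -> ancestor j m -> ancestor i m.
Proof.
move=> /ancestorP[a ->] /ancestorP[b ->]; apply/ancestorP.
by exists (a + b); rewrite iterD.
Qed.

Lemma ancestor_leq i j : ancestor i j -> i <= j.
Proof.
case/ancestorP=> m ->; apply: leq_trans (iter_par_le m j) (leq_subr _ _).
Qed.

Lemma ancestor0 j : ancestor 0 j.
Proof.
apply/ancestorP; exists j; apply/esym/eqP; rewrite -leqn0.
by have := iter_par_le j j; rewrite subnn.
Qed.

Lemma ancestor_step i j : ancestor i j -> i != j -> ancestor i (par j).
Proof.
case/ancestorP=> [[|m]] -> ; first by rewrite eqxx.
by rewrite iterSr => _; apply/ancestorP; exists m.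
Qed.

Lemma ancestor_total i j m :
  ancestor i m -> ancestor j m -> i <= j -> ancestor i j.
Proof.
case/ancestorP=> a ->; case/ancestorP=> b -> le.
case/orP: (leq_total b a) => ab.
  by apply/ancestorP; exists (a - b); rewrite -iterD subnK.
have: ancestor (iter b par m) (iter a par m).
  by apply/ancestorP; exists (b - a); rewrite -iterD subnK.
move/ancestor_leq => ge; have -> : iter a par m = iter b par m.
  by apply/eqP; rewrite eqn_leq le.
exact: ancestor_refl.
Qed.

Lemma ancestor_child i j :
  ancestor i j -> i != j -> exists m, [/\ par m = i, i < m & ancestor m j].
Proof.
elim/ltn_ind: j => j IH ij ne.
have lt_ij : i < j by rewrite ltn_neqAle ne ancestor_leq.
have [<-|ne'] := eqVneq (par j) i.
  exists j; split; rewrite ?ancestor_refl //.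
  by apply: leq_ltn_trans (par_le j) _; rewrite ltn_predL (leq_ltn_trans _ lt_ij).
have [| | |m [pm im mj]] := IH (par j).
- by apply: leq_ltn_trans (par_le j) _; rewrite ltn_predL (leq_ltn_trans _ lt_ij).
- exact: ancestor_step.
- by rewrite eq_sym.
by exists m; split=> //; apply: ancestor_trans mj (ancestor_par j).
Qed.

(** Common ancestors lie on the path from [a] to the root, hence form a chain, and the one with the
    largest number is the lowest. *)
Lemma lowest_common_ancestor a b : exists m,
  [/\ ancestor m a, ancestor m b &
      forall i, ancestor i a -> ancestor i b -> ancestor i m].
Proof.
have ex0 : exists i, ancestor i a && ancestor i b by exists 0; rewrite !ancestor0.
have ub i : ancestor i a && ancestor i b -> i <= a by case/andP=> /ancestor_leq.
case: (ex_maxnP ex0 ub) => m /andP[ma mb] mmax; exists m; split=> // i ia ib.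
by apply: (ancestor_total ia ma); apply: mmax; rewrite ia.
Qed.

End Ancestors.

Record rooted_decomposition (G : sgraph) n (par : nat -> nat)
    (bag : nat -> {set G}) (k : nat) : Prop := RootedDecomposition {
  rd_par : forall j, par j <= j.-1;
  rd_bound : forall i, n <= i -> bag i = set0;
  rd_cover : forall v, exists i, v \in bag i;
  rd_edge : forall u v, adj u v -> exists2 i, u \in bag i & v \in bag i;
  rd_conn : forall v i j, i < j -> v \in bag i -> v \in bag j -> v \in bag (par j);
  rd_width : forall i, #|bag i| <= k.+1 }.

Section RootedDecomposition.
Variables (G : sgraph) (n : nat) (par : nat -> nat) (bag : nat -> {set G}) (k : nat).
Hypothesis rd : rooted_decomposition n par bag k.
Let par_le := rd_par rd.

(** The tree edge from [j] to its parent separates the subtree at [j] from the rest. Replacing the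
    larger of [a] and [b] by its parent keeps [v] in both bags, and this can only end with [a = j]
    about to leave the subtree. *)
Lemma bag_cross v a b j :
  ancestor par j a -> ~~ ancestor par j b -> v \in bag a -> v \in bag b ->
  v \in bag j /\ v \in bag (par j).
Proof.
move: {2}(a + b) (leqnn (a + b)) => s.
elim: s a b => [|s IH] a b.
  rewrite leqn0 addn_eq0 => /andP[/eqP -> /eqP ->] j0.
  by rewrite j0.
move=> les ja jb va vb.
have dec i : 0 < i -> par i < i.
  by move=> i0; apply: leq_ltn_trans (par_le i) _; rewrite ltn_predL.
case: (ltngtP a b) => [ab|ba|eab]; last by rewrite -eab ja in jb.
- apply: (IH a (par b)) => //.
  + rewrite -ltnS; apply: leq_trans les.
    by rewrite ltn_add2l dec // (leq_ltn_trans _ ab).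
  + by apply: contra jb => /ancestor_trans; apply=> //; apply: ancestor_par.
  + exact: (rd_conn rd ab va vb).
- have vpa := rd_conn rd ba vb va.
  have [->|ne] := eqVneq j a; first by [].
  apply: (IH (par a) b) => //.
  + rewrite -ltnS; apply: leq_trans les.
    by rewrite ltn_add2r dec // (leq_ltn_trans _ ba).
  + exact: ancestor_step.
Qed.

(** Take the least node whose bag contains [v]: by [rd_conn] any later occurrence climbs through
    parents until it reaches that node. *)
Lemma top_bag v : exists2 i, v \in bag i & forall j, v \in bag j -> ancestor par i j.
Proof.
case: (ex_minnP (rd_cover rd v)) => i vi imin; exists i => // j.
elim/ltn_ind: j => j IH vj; have := imin j vj; rewrite leq_eqVlt.
case/predU1P => [<-|ij]; first exact: ancestor_refl.
apply: (ancestor_trans par_le) (ancestor_par par_le j); apply: IH.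
  apply: leq_ltn_trans (par_le j) _; rewrite ltn_predL; exact: leq_ltn_trans ij.
exact: (rd_conn rd ij vi vj).
Qed.

Definition inside j v := [exists a : 'I_n, ancestor par j a && (v \in bag a)].

Lemma insideP j v :
  reflect (exists2 a, ancestor par j a & v \in bag a) (inside j v).
Proof.
apply: (iffP existsP) => [[a /andP[ja va]]|[a ja va]]; first by exists a.
case: (ltnP a n) => [an|/(rd_bound rd) a0]; last by rewrite a0 inE in va.
by exists (Ordinal an); rewrite ja.
Qed.

(** The vertices common to the bags at [j] and [par j] separate the inside of [j] from the outside,
    so a connected set avoiding them stays on one side. *)
Lemma connected_inside (X : {set G}) j x y :
  connected_set X ->
  {in X, forall z, z \in bag j -> z \notin bag (par j)} ->
  x \in X -> y \in X -> inside j x -> inside j y.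
Proof.
move=> cX X0; apply: (connected_constant cX) => a b aX bX ab.
case/insideP=> m jm am; have [i ai bi] := rd_edge rd ab.
have [ji|nji] := boolP (ancestor par j i); first by apply/insideP; exists i.
have [aj apj] := bag_cross jm nji am ai.
by have := X0 a aX aj; rewrite apj.
Qed.

(* [Z] is the union of the bags at the lowest common ancestors of the top nodes
   of the vertices of [Q]. If [j] is the top node of a component of [~: Z], its
   neighbours in [Z] lie in the bag at [j] or in the first of these bags below
   [j]. *)
Lemma closure_small_attachments (Q : {set G}) : exists Z : {set G},
  [/\ Q \subset Z, #|Z| <= #|Q| * #|Q| * k.+1 &
   forall K, component (~: Z) K -> #|nbh K :&: Z| <= 2 * k.+1].
Proof.
have [top v_top _] := fin_all_exists2 top_bag.
have exm (q : G * G) := lowest_common_ancestor par_le (top q.1) (top q.2).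
have [m mP] := fin_all_exists exm.
pose Z := \bigcup_(q in setX Q Q) bag (m q).
exists Z; split.
- apply/subsetP=> v vQ; apply/bigcupP; exists (v, v); first by rewrite inE vQ.
  have [m1 _ m3] := mP (v, v).
  suff -> : m (v, v) = top v by [].
  apply/eqP; rewrite eqn_leq (ancestor_leq par_le m1).
  by apply/(ancestor_leq par_le)/m3; apply: ancestor_refl.
- rewrite -cardsX -sum_nat_const.
  rewrite /Z; elim/big_rec2: _ => [|p s A _ IH]; first by rewrite cards0.
  apply: leq_trans (leq_card_setU _ _) _; rewrite leq_add //.
  exact: (rd_width rd).
move=> K cK.
have cnK := component_connected cK.
have KZ x q : x \in K -> q \in setX Q Q -> x \notin bag (m q).
  move=> xK qQ; have := subsetP (component_sub cK) x xK; rewrite inE.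
  by apply: contra => xq; apply/bigcupP; exists q.
have /set0Pn[x0 x0K] := component_neq0 cK.
have exj : exists j, [exists x in K, x \in bag j].
  have [i x0i] := rd_cover rd x0; exists i; apply/existsP.
  by exists x0; rewrite x0K.
case: (ex_minnP exj) => j /existsP[x /andP[xK xj]] jmin.
(* [j] is the least node whose bag meets [K]. Hence [K] avoids the bag at [par j] and cannot cross
   that tree edge. *)
have ins y a : y \in K -> y \in bag a -> ancestor par j a.
  move=> yK ya; apply: contraT => nja.
  have j0 : 0 < j by case: (posnP j) nja => // ->; rewrite ancestor0.
  have par0 : {in K, forall z, z \notin bag (par j)}.
    move=> z zK; apply/negP=> zj.
    have := jmin (par j); rewrite leqNgt.
    suff -> : par j < j.
      by move=> /(_ _)/negP; apply; [apply/existsP; exists z; rewrite zK|].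
    by apply: leq_ltn_trans (par_le j) _; rewrite ltn_predL.
  have : inside j y.
    apply: (connected_inside cnK _ xK yK).
      by move=> z zK _; apply: par0.
    by apply/insideP; exists j; rewrite ?ancestor_refl.
  case/insideP=> b jb yb; have [_ yp] := bag_cross jb nja yb ya.
  by have := par0 y yK; rewrite yp.
have cross z : z \in nbh K -> exists i y, [/\ y \in K, y \in bag i & z \in bag i].
  case/mem_nbh=> y yK yz; have [i yi zi] := rd_edge rd yz.
  by exists i, y.
have bound1 : #|bag j| <= k.+1 := rd_width rd j.
pose below i := [exists q in setX Q Q, (m q == i) && ancestor par j i].
have [/existsP[q0 /andP[q0Q jq0]]|nbelow] :=
    boolP [exists q in setX Q Q, ancestor par j (m q)].
  have exm1 : exists i, below i.
    by exists (m q0); apply/existsP; exists q0; rewrite q0Q eqxx.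
  case: (ex_minnP exm1) => m1 /existsP[s /and3P[sQ /eqP sm1 jm1]] m1min.
  (* Closure under lowest common ancestors enters here: [m (s.1, r)] lies below [j], is comparable
     with [m1], and by minimality of [m1] lies below it. *)
  have all_below q : q \in setX Q Q -> ancestor par j (m q) -> ancestor par m1 (m q).
    move=> qQ jq; have [mq1 mq2 mq3] := mP q.
    have [ms1 ms2 ms3] := mP s; rewrite sm1 in ms1 ms2 ms3.
    have aux r : r \in Q -> ancestor par j (top r) -> ancestor par m1 (top r).
      move=> rQ jr; have [n1 n2 n3] := mP (s.1, r).
      apply: (ancestor_trans par_le _ n2); apply: (ancestor_total par_le ms1 n1).
      apply: m1min; apply/existsP; exists (s.1, r).
      apply/and3P; split; rewrite ?eqxx //.
        by move: sQ; rewrite !inE rQ andbT => /andP[].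
      by apply: n3 => //; apply: (ancestor_trans par_le jm1).
    move: qQ; rewrite inE => /andP[q1 q2].
    by apply: mq3; apply: aux => //; apply: (ancestor_trans par_le jq).
  (* [K] avoids the bag at [m1] but has the vertex [x] in the bag at [j], above [m1]; so it stays
     outside the subtree at [m1]. *)
  have Kout i y : y \in K -> y \in bag i -> ~~ ancestor par m1 i.
    move=> yK yi; apply: contraT; rewrite negbK => m1i.
    have K0 : {in K, forall z, z \notin bag m1}.
      by move=> z zK; rewrite -sm1; apply: KZ.
    have : inside m1 x.
      apply: (connected_inside cnK _ yK xK).
        by move=> z /K0/negP.
      by apply/insideP; exists i.
    case/insideP=> b m1b xb.
    have [m1j|nm1j] := boolP (ancestor par m1 j).
      have /eqP e : j == m1 by rewrite eqn_leq !(ancestor_leq par_le).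
      by move: (KZ x s xK sQ); rewrite sm1 -e xj.
    have [xm1 _] := bag_cross m1b nm1j xb xj.
    by have := K0 x xK; rewrite xm1.
  apply: (@leq_trans #|bag j :|: bag m1|); last first.
    by apply: leq_trans (leq_card_setU _ _) _; rewrite mul2n -addnn leq_add ?(rd_width rd).
  apply/subset_leq_card/subsetP=> z /setIP[zK /bigcupP[q qQ zq]]; rewrite inE.
  have [i [y [yK yi zi]]] := cross z zK.
  have [jq|njq] := boolP (ancestor par j (m q)).
    have [-> _] := bag_cross (all_below q qQ jq) (Kout i y yK yi) zq zi.
    by rewrite orbT.
  by have [-> _] := bag_cross (ins y i yK yi) njq zi zq.
apply: (@leq_trans #|bag j|); last by rewrite (leq_trans bound1) // leq_pmull.
apply/subset_leq_card/subsetP=> z /setIP[zK /bigcupP[q qQ zq]].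
have [i [y [yK yi zi]]] := cross z zK.
have njq : ~~ ancestor par j (m q).
  by apply: contra nbelow => jq; apply/existsP; exists q; rewrite qQ.
by have [-> _] := bag_cross (ins y i yK yi) njq zi zq.
Qed.

(* Let [Y A] be a component of [X :\: A] witnessing that [A] fails. For the last
   node [i] such that [Y (bag i)] lies below [i], there is a child [j] of [i] such
   that [Y (bag i)] is inside the subtree at [j] and [Y (bag j)] is outside. Then
   [bag i] and [bag j] share the [c] singletons and a vertex of [X], hence they
   are equal. *)
Lemma ndisjointed_singletons :
  ndisjointed k k.+1 [set [set x] | x : G].
Proof.
move=> Bs bBs X cX.
have exx i : exists x, Bs i = [set x] by case/imsetP: (bBs i) => x; exists x.
have [x xP] := fin_all_exists exx.
pose N (a : 'I_k) := nbh (Bs a :\: \bigcup_(b < k | (b < a)%N) Bs b).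
pose good A := [forall Y in components (X :\: A), [exists a, Y :&: N a == set0]].
have [/existsP[i gi]|/existsPn bad] := boolP [exists i : 'I_n, good (bag i)].
  exists (X :&: bag i); split; first exact: subsetIl.
    by apply: leq_trans (subset_leq_card (subsetIr _ _)) (rd_width rd i).
  move=> Y; rewrite setDIr setDv set0U => /componentP cY.
  have /existsP[a /eqP Ya] := implyP (forallP gi Y) cY.
  by exists a.
(* The witness depends on the set [A], not on the node, so that equal bags yield the same component;
   the final contradiction rests on this. *)
have exY A : exists Y, ~~ good A ->
    component (X :\: A) Y /\ forall a, Y :&: N a != set0.
  have [gA|/forallPn[Y]] := boolP (good A); first by exists set0.
  by rewrite negb_imply => /andP[/componentP cY /existsPn Ya]; exists Y.
have [F FP] := fin_all_exists exY.
pose Y i := F (bag i).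
have YP i : i < n -> component (X :\: bag i) (Y i) /\ forall a, Y i :&: N a != set0.
  by move=> lt; apply: (FP _ (bad (Ordinal lt))).
have Ybag i y : i < n -> y \in Y i -> y \notin bag i.
  by case/YP=> cY _ /(subsetP (component_sub cY)) /setDP[].
pose P i := (i < n) && [forall y in Y i, inside i y].
have exP : exists i, P i.
  have /set0Pn[v vX] := component_neq0 cX; have [i vi] := rd_cover rd v.
  exists 0; apply/andP; split.
    by rewrite lt0n; apply/eqP=> n0; rewrite (rd_bound rd) ?n0 // inE in vi.
  apply/forall_inP=> y _; have [j yj] := rd_cover rd y.
  by apply/insideP; exists j; rewrite ?ancestor0.
have ubP i : P i -> i <= n by case/andP=> /ltnW.
case: (ex_maxnP exP ubP) => i /andP[ltin /forall_inP iY] imax.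
have [cYi Yin] := YP i ltin.
have /set0Pn[v vY] := component_neq0 cYi.
have [a ia va] := insideP _ _ (iY v vY).
have ltan : a < n.
  by rewrite ltnNge; apply/negP=> /(rd_bound rd) a0; rewrite a0 inE in va.
have [|j [pj ij ja]] := ancestor_child par_le ia.
  by apply: contraTneq va => <-; apply: Ybag.
have ltjn : j < n := leq_ltn_trans (ancestor_leq par_le ja) ltan.
have [cYj Yjn] := YP j ltjn.
have Yi_in y : y \in Y i -> inside j y.
  move=> yY; apply: (connected_inside (component_connected cYi) _ vY yY).
    by move=> z zY _; rewrite pj; apply: Ybag.
  by apply/insideP; exists a.
(* [j] comes after the last node [i], so some vertex of [Y j] is outside the subtree at [j]; as
   [Y j] avoids the bag at [j], all of it is. *)
have Yj_out y : y \in Y j -> ~~ inside j y.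
  move=> yY; apply/negP=> iny; have: P j; last by move/imax; rewrite leqNgt ij.
  rewrite /P ltjn; apply/forall_inP=> z zY.
  apply: (connected_inside (component_connected cYj) _ yY zY) iny.
  by move=> t tY tj; have := Ybag j t ltjn tY; rewrite tj.
have nbr (A : {set G}) b : A :&: N b != set0 -> exists2 u, u \in A & adj (x b) u.
  case/set0Pn=> u /setIP[uA /mem_nbh[z /setDP[]]].
  by rewrite xP inE => /eqP -> _ ux; exists u.
(* [x b] has a neighbour in [Y i], inside [j], and one in [Y j], outside, so it occurs in bags on
   both sides of the edge from [j] to [i]. *)
have xij b : (x b \in bag j) && (x b \in bag i).
  have [u uY ux] := nbr _ b (Yin b); have [u' uY' ux'] := nbr _ b (Yjn b).
  have [m xm um] := rd_edge rd ux; have [m' xm' um'] := rd_edge rd ux'.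
  have jm : ancestor par j m.
    apply: contraT => njm; have [l jl ul] := insideP _ _ (Yi_in u uY).
    have [_] := bag_cross jl njm ul um; rewrite pj => ui.
    by have := Ybag i u ltin uY; rewrite ui.
  have njm' : ~~ ancestor par j m'.
    apply: contra (Yj_out u' uY') => jm'; by apply/insideP; exists m'.
  by have [-> ] := bag_cross jm njm' xm xm'; rewrite pj => ->.
have [z zX zij] : exists2 z, z \in X & (z \in bag j) && (z \in bag i).
  have [/existsP[z /and3P[? ? ?]]|/existsPn nz] :=
    boolP [exists z, [&& z \in X, z \in bag j & z \in bag i]].
    by exists z => //; apply/andP.
  have /set0Pn[u uY] := component_neq0 cYj.
  have uX := subsetP (subset_trans (component_sub cYj) (subsetDl _ _)) u uY.
  have vX := subsetP (subset_trans (component_sub cYi) (subsetDl _ _)) v vY.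
  case/negP: (Yj_out u uY).
  apply: (connected_inside (component_connected cX) _ vX uX) (Yi_in v vY).
  by move=> z zX zj; have := nz z; rewrite zX zj pj.
(* Of two equal singletons the later loses its vertex to the earlier, so its [N b] would be empty
   and [Y i] could not meet it. *)
have xinj : injective x.
  move=> b b' exb; apply/val_inj/eqP; move: b b' exb.
  suff lt b b' : x b = x b' -> b <= b'.
    by move=> b b' exb; rewrite eqn_leq !lt.
  move=> exb; rewrite leqNgt; apply/negP=> b'b.
  have /set0Pn[u /setIP[_ /mem_nbh[y /setDP[]]]] := Yin b.
  rewrite xP inE => /eqP -> /bigcupP[]; exists b' => //.
  by rewrite xP exb inE.
have zx : z \notin [set x b | b : 'I_k].
  apply/imsetP=> -[b _ zb]; have := subsetP (component_sub cX) z zX.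
  by rewrite inE => /bigcupP[]; exists b => //; rewrite xP zb inE.
pose D := z |: [set x b | b : 'I_k].
have cD : #|D| = k.+1 by rewrite cardsU1 zx card_imset // card_ord.
have eD l : D \subset bag l -> D = bag l.
  by move=> s; apply/eqP; rewrite eqEcard s cD (rd_width rd).
have e : bag i = bag j.
  have sub l : z \in bag l -> (forall b, x b \in bag l) -> D \subset bag l.
    move=> zl xl; rewrite subUset sub1set zl.
    by apply/subsetP=> _ /imsetP[b _ ->].
  have [zj zi] := andP zij.
  have <- : D = bag i by apply/eD/sub => // b; case/andP: (xij b).
  by apply/eD/sub => // b; case/andP: (xij b).
have eY : Y i = Y j by rewrite /Y e.
by have := Yj_out v; rewrite -eY vY Yi_in // => /(_ isT).
Qed.

End RootedDecomposition.

(** * Passing between tree decompositions and rooted ones *)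

Lemma connected_enumeration (T : sgraph) (t0 : T) m :
  connected_graph T -> 0 < m <= #|T| ->
  exists s : seq T, [/\ uniq s, size s = m &
    forall j, 0 < j < m -> exists2 i, i < j & adj (nth t0 s i) (nth t0 s j)].
Proof.
move=> cT; elim: m => [|[|m] IH] //.
  by exists [:: t0]; split=> // -[|j].
move=> /= ltmT; case: IH => [|s [us ss sP]]; first exact: ltnW.
have [t ts] : exists t, t \notin s.
  apply/existsP; rewrite -negb_forall; apply: contraL ltmT => /forallP all_s.
  rewrite -leqNgt -ss -(card_uniqP us); apply/subset_leq_card/subsetP=> t _.
  exact: all_s.
have s0 : head t0 s \in s by case: (s) ss => //= x s' _; rewrite mem_head.
have [/existsP[u /existsP[v /and3P[us' vs uv]]]|/existsPn no] :=
    boolP [exists u, exists v, [&& u \in s, v \notin s & adj u v]].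
  exists (rcons s v); rewrite rcons_uniq vs us size_rcons ss.
  split=> // j /andP[j0]; rewrite ltnS leq_eqVlt => /predU1P[->|ltjm].
    exists (index u s); first by rewrite -ss index_mem.
    by rewrite !nth_rcons index_mem us' nth_index // ss ltnn eqxx.
  have [|i ij ad] := sP j; first by rewrite j0.
  by exists i; rewrite // !nth_rcons ss ltjm (ltn_trans ij).
case/negP: ts; apply: (connect_closed (P := mem s) _ s0 (cT (head t0 s) t)).
move=> u v us' uv; apply: contraT => vs; have /existsPn/(_ v) := no u.
by rewrite [u \in s]us' vs uv.
Qed.

(** Enumerate the tree so that each node after the first has an earlier neighbour, its parent;
    acyclicity makes it unique. If [par j] misses [v], the bags containing [v] that are reached from
    [j] stay below [j], which gives [rd_conn]. *)
Lemma tw_le_rooted (G : sgraph) k :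
  tw_le G k -> exists n par (bag : nat -> {set G}), rooted_decomposition n par bag k.
Proof.
case=> T [bag [[[T0 cT aT] cov edge conn] wd]].
have /card_gt0P[t0 _] := T0.
have [|s [us ss sP]] := connected_enumeration t0 (m := #|T|) cT.
  by rewrite T0 leqnn.
pose nd := nth t0 s.
(* The cap [j.-1] makes [par_le] hold at the root and off the list; elsewhere it is inactive. *)
pose par j := minn (find (fun u => adj u (nd j)) s) j.-1.
have par_le j : par j <= j.-1 by apply: geq_minr.
have parP j : 0 < j < size s -> par j < j /\ adj (nd (par j)) (nd j).
  rewrite ss => jP; have [i ij ad] := sP j jP.
  have jT : j < size s by case/andP: jP; rewrite ss.
  have has_j : has (fun u => adj u (nd j)) s.
    by apply/hasP; exists (nd i) => //; apply/mem_nth/(ltn_trans ij).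
  have le_i : find (fun u => adj u (nd j)) s <= i.
    by rewrite leqNgt; apply/negP=> /(before_find t0); rewrite ad.
  have -> : par j = find (fun u => adj u (nd j)) s.
    apply/minn_idPl/(leq_trans le_i); rewrite -ltnS prednK //.
    by case/andP: jP.
  by split; [apply: leq_ltn_trans ij | apply: (nth_find t0 has_j)].
have mem_s t : t \in s.
  have [|| _ ->] := uniq_min_size (s2 := enum T) us; rewrite ?mem_enum //.
    by move=> x _; rewrite mem_enum.
  by rewrite -cardE ss.
have nd_inj i j : i < size s -> j < size s -> nd i = nd j -> i = j.
  by move=> il jl /eqP; rewrite nth_uniq // => /eqP.
(* a further edge would close a cycle *)
have tree_edge i j : i < j -> j < size s -> adj (nd i) (nd j) -> i = par j.
  move=> ij jl ad; have j0 : 0 < j := leq_ltn_trans (leq0n i) ij.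
  have [|pj apj] := parP j; first by rewrite j0.
  pose A := [set nd m | m : 'I_j].
  have inA m : m < j -> nd m \in A.
    by move=> mj; apply: (imset_f (fun m : 'I_j => nd m) (x := Ordinal mj)).
  have to0 m : m < j -> connect (induced_rel A) (nd m) (nd 0).
    elim/ltn_ind: m => -[|m] IH mj; first exact: connect0.
    have [|pm apm] := parP m.+1; first exact: ltn_trans jl.
    apply: connect_trans (IH _ pm (ltn_trans pm mj)); apply: connect1.
    by rewrite induced_relE !inA ?(ltn_trans pm) // adj_sym.
  have: connect (induced_rel A) (nd (par j)) (nd i).
    by apply: connect_trans (to0 _ pj) _; rewrite connect_induced_sym to0.
  case/connectP=> p0 /shortenP[p pA up _] ei.
  case: p pA up ei => [_ _ /= ei|y p pA up ei].
    by apply: nd_inj ei; [apply: ltn_trans ij jl|apply: ltn_trans pj jl].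
  case: (aT (nd j :: nd (par j) :: y :: p)) => //.
  have pT x q : path (induced_rel A) x q -> path (@adj T) x q.
    by apply: sub_path => a b /and3P[].
  have qA : all (mem A) (nd (par j) :: y :: p).
    rewrite /= inA // -/(all (mem A) (y :: p)).
    move: {up ei} (nd (par j)) (y :: p) pA => x q.
    by elim: q x => //= z q IH x /andP[/and3P[_ -> _]] /IH.
  apply/andP; split.
    rewrite /cycle rcons_path /= [adj (nd j) _]adj_sym apj /=.
    have /= -> := pT _ _ pA; by rewrite -[last y p]/(last (nd (par j)) (y :: p)) -ei.
  rewrite cons_uniq up andbT; apply/negP=> /(allP qA) /imsetP[m _ /nd_inj e].
  by have := ltn_ord m; rewrite -e ?ltnn // (ltn_trans (ltn_ord m)).
pose bag' i := if i < size s then bag (nd i) else set0.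
have idx t : nd (index t s) = t by apply: nth_index.
have idx_lt t : index t s < size s by rewrite index_mem.
have bag'_lt v i : v \in bag' i -> i < size s /\ v \in bag (nd i).
  by rewrite /bag'; case: ifP; rewrite ?inE.
have bag'E t : bag' (index t s) = bag t by rewrite /bag' idx_lt idx.
exists (size s), par, bag'; split=> //.
- by move=> i; rewrite leqNgt /bag' => /negbTE ->.
- by move=> v; have [t vt] := cov v; exists (index t s); rewrite bag'E.
- by move=> u v /edge[t /andP[ut vt]]; exists (index t s); rewrite bag'E.
- move=> v i j ij /bag'_lt[il vi] /bag'_lt[jl vj].
  have j0 : 0 < j := leq_ltn_trans (leq0n i) ij.
  have [|pj _] := parP j; first by rewrite j0.
  rewrite /bag' (ltn_trans pj jl); apply: contraT => nv.
  have: ancestor par j (index (nd i) s).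
    apply: (connect_closed (P := fun t => ancestor par j (index t s))
      _ _ (conn v _ _ vj vi)).
      move=> a b ja /and3P[ab va vb].
      case: (ltngtP (index a s) (index b s)) => [lt|lt|e].
      - have e : index a s = par (index b s) by apply: tree_edge; rewrite ?idx.
        by apply: (ancestor_trans par_le ja); rewrite e; apply: ancestor_par.
      - have e : index b s = par (index a s) by apply: tree_edge; rewrite ?idx // adj_sym.
        rewrite e; apply: ancestor_step ja _ => //; apply: contra nv => /eqP jE.
        by rewrite jE -e idx.
      - by rewrite -e.
    by rewrite index_uniq // ancestor_refl.
  by move/(ancestor_leq par_le); rewrite index_uniq // leqNgt ij.
- by move=> i; rewrite /bag'; case: ifP => _; rewrite ?cards0.
Qed.

Section TreeOfParents.
Variables (n : nat) (par : nat -> nat).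
Hypothesis par_le : forall j, par j <= j.-1.

(** The inequality removes the loop at the root, where [par 0 = 0]. *)
Definition parent_adj : rel 'I_n.+1 :=
  [rel i j : 'I_n.+1 | (i != j) && ((par i == j) || (par j == i))].

Lemma parent_adjE i j :
  parent_adj i j = (i != j) && ((par i == j) || (par j == i)).
Proof. by []. Qed.

Lemma parent_adj_sym : symmetric parent_adj.
Proof. by move=> i j; rewrite !parent_adjE eq_sym orbC. Qed.

Lemma parent_adj_irr : irreflexive parent_adj.
Proof. by move=> i; rewrite parent_adjE eqxx. Qed.

Definition parent_tree := SGraph parent_adj_sym parent_adj_irr.

Lemma par_lt j : 0 < j -> par j < j.
Proof. by move=> j0; apply: leq_ltn_trans (par_le j) _; rewrite ltn_predL. Qed.

Lemma ltn_par (j : 'I_n.+1) : par j < n.+1.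
Proof.
by apply: leq_ltn_trans (ltn_ord j); apply: leq_trans (par_le j) (leq_pred _).
Qed.

Lemma parent_adj_par (j : 'I_n.+1) : 0 < j -> parent_adj j (Ordinal (ltn_par j)).
Proof.
by move=> j0; rewrite parent_adjE eqxx andbT -val_eqE /= neq_ltn par_lt // orbT.
Qed.

Lemma parent_tree_is_tree : is_tree parent_tree.
Proof.
split; first by rewrite card_ord.
  have to0 (j : parent_tree) : connect (@adj parent_tree) j ord0.
    case: j => j; elim/ltn_ind: j => -[|j] IH lt.
      by rewrite (_ : Ordinal lt = ord0) ?connect0 //; apply: val_inj.
    apply: connect_trans (connect1 (parent_adj_par (j := Ordinal lt) _)) _ => //.
    exact/IH/par_lt.
  move=> i j; apply: connect_trans (to0 i) _.
  by rewrite (sym_connect_sym (@adj_sym parent_tree)).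
(* both neighbours on a cycle of its largest node are the parent of that node *)
move=> cyc sz /andP[cy ucy].
have [m mc mmax] : exists2 m : parent_tree, m \in cyc & forall i, i \in cyc -> i <= m.
  case: cyc sz cy ucy => // x cyc _ _ _.
  have [m mc mmax] := arg_maxnP (fun i : 'I_n.+1 => i : nat)
    (mem_head x cyc : (fun i : 'I_n.+1 => i \in x :: cyc) x).
  by exists m.
have [i p eq_p] := rot_to mc.
have: cycle parent_adj (m :: p) by rewrite -eq_p rot_cycle.
have up : uniq (m :: p) by rewrite -eq_p rot_uniq.
have szp : size (m :: p) = size cyc by rewrite -eq_p size_rot.
have pm j : j \in m :: p -> j <= m by rewrite -eq_p mem_rot; apply: mmax.
have nbr j : j \in p -> parent_adj m j -> val j = par m.
  move=> jp /andP[ne]; case/orP=> /eqP // e.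
  have := pm j; rewrite inE jp orbT => /(_ isT) jm.
  have lt : j < m by rewrite ltn_neqAle jm andbT eq_sym.
  have := par_le j; rewrite e => le.
  by have := leq_trans le (leq_pred j); rewrite leqNgt lt.
case: p szp up pm nbr {eq_p} => [|x [|y p]] szp up pm nbr; try by rewrite -szp in sz.
rewrite /cycle rcons_path => /andP[/andP[mx _] lm].
have ex := nbr x (mem_head _ _) mx.
have el : val (last y p) = par m.
  by apply: nbr; [rewrite inE mem_last orbT|rewrite parent_adj_sym].
have e : x = last y p by apply: val_inj; rewrite ex el.
by move: up; rewrite /= e mem_last /= !andbF.
Qed.

End TreeOfParents.

(** Every occurrence of [v] climbs through bags containing [v] to its top node, which therefore
    connects all of them. *)
Lemma rooted_tw_le (G : sgraph) n par (bag : nat -> {set G}) k :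
  rooted_decomposition n par bag k -> tw_le G k.
Proof.
move=> rd; have par_le := rd_par rd.
have lt_n i v : v \in bag i -> i < n.+1.
  by move=> vi; rewrite ltnS leqNgt; apply/negP=> /ltnW/(rd_bound rd) e; rewrite e inE in vi.
(* The tree has the extra node [n], with an empty bag, so that it is non-empty even for [n = 0]. *)
exists (parent_tree n par), (fun i : parent_tree n par => bag (val i)).
split; last by move=> t; apply: rd_width rd _.
split; first exact: parent_tree_is_tree.
- move=> v; have [i vi] := rd_cover rd v.
  by exists (Ordinal (lt_n i v vi)).
- move=> u v uv; have [i ui vi] := rd_edge rd uv.
  by exists (Ordinal (lt_n i v vi)); rewrite /= ui.
move=> v; have [top vtop topP] := top_bag rd v.
set r := [rel a b | _].
have r_sym : connect_sym r.
  apply: sym_connect_sym => a b.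
  by apply/and3P/and3P => -[ab va vb]; split=> //; rewrite adj_sym.
have to_top (i : parent_tree n par) : v \in bag (val i) ->
    connect r i (Ordinal (lt_n top v vtop)).
  case: i => i; elim/ltn_ind: i => i IH lt /= vi.
  have [e|ne] := eqVneq i top.
    by rewrite (_ : Ordinal lt = Ordinal (lt_n top v vtop)) ?connect0 //; apply: val_inj.
  have ti : top < i.
    by rewrite ltn_neqAle eq_sym ne (ancestor_leq par_le (topP i vi)).
  have vp := rd_conn rd ti vtop vi.
  have i0 : 0 < i := leq_ltn_trans (leq0n _) ti.
  apply: connect_trans (connect1 _) (IH (par i) _ (ltn_par par_le (Ordinal lt)) vp).
    by apply/and3P; split=> //; apply: (parent_adj_par par_le (j := Ordinal lt)).
  exact: par_lt.
move=> i j vi vj; apply: connect_trans (to_top i vi) _.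
by rewrite r_sym to_top.
Qed.

(** * Building the tree-partition *)

Section TreePartition.
Variables (G : sgraph) (c : nat).

(* The quotient of [W] by the labelling [p] has a rooted decomposition of width at
   most [c] on the nodes [0 .. n.-1]; labels are nodes as well. The last clause
   says that the neighbours in [W] of a component of [~: W] carry only labels
   [s a] from a single bag, and that those labelled [s a] lie in a small set
   [h a]. *)
Record partial_partition (U : {set {set G}}) (w : nat) (W : {set G})
    (p : G -> nat) n (par : nat -> nat) (bag : nat -> seq nat) : Prop :=
  PartialPartition {
  pp_pos : 0 < n;
  pp_par : forall j, par j <= j.-1;
  pp_label : {in W, forall u, p u < n};
  pp_bag_le : forall i x, x \in bag i -> x <= i;
  pp_bag_self : forall i, i < n -> i \in bag i;
  pp_bag_size : forall i, size (bag i) <= c.+1;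
  pp_conn : forall x i j, i < j -> j < n ->
    x \in bag i -> x \in bag j -> x \in bag (par j);
  pp_edge : {in W &, forall u v, adj u v ->
    exists i, [/\ i < n, p u \in bag i & p v \in bag i]};
  pp_width : forall x, #|[set u in W | p u == x]| <= w;
  pp_attached : forall Y, component (~: W) Y ->
    exists t (s : nat -> nat) (h : nat -> {set G}),
    [/\ t < n, forall a, a < c -> s a \in bag t,
        forall a, a < c -> h a \in U /\ [disjoint h a & Y] &
        forall u, u \in W -> u \in nbh Y -> exists a,
          [/\ a < c, u \in h a, forall b, b < a -> u \notin h b & p u = s a]] }.

Lemma partial_partition0 (U : {set {set G}}) w : set0 \in U ->
  partial_partition U w set0 (fun=> 0) 1 (fun=> 0) (fun i => [:: i]).
Proof.
move=> U0; split=> //.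
- by move=> i x; rewrite inE => /eqP ->.
- by move=> i; rewrite inE.
- by move=> x i [|j].
- by move=> u v; rewrite inE.
- move=> x; rewrite (_ : [set _ in _ | _] = set0) ?cards0 //.
  by apply/setP=> u; rewrite !inE.
move=> Y _; exists 0, (fun=> 0), (fun=> set0); split=> //.
  by move=> a _; rewrite disjoints_subset sub0set.
by move=> u; rewrite inE.
Qed.

Section Quotient.
Variables (U : {set {set G}}) (w : nat) (p : G -> nat) (n : nat)
  (par : nat -> nat) (bag : nat -> seq nat).
Hypothesis pp : partial_partition U w [set: G] p n par bag.

(** Joining all labels that share a bag turns [pp_edge] into the condition for an [H]-partition,
    with [bag] still a decomposition. *)
Definition quotient_adj : rel 'I_n :=
  fun x y => (x != y) && [exists i : 'I_n, (val x \in bag i) && (val y \in bag i)].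

Lemma quotient_adj_sym : symmetric quotient_adj.
Proof.
move=> x y; rewrite /quotient_adj eq_sym; congr (_ && _).
by apply: eq_existsb => i; apply: andbC.
Qed.

Lemma quotient_adj_irr : irreflexive quotient_adj.
Proof. by move=> x; rewrite /quotient_adj eqxx. Qed.

Lemma partial_partition_tpw_le : tpw_le c G w.
Proof.
pose H := SGraph quotient_adj_sym quotient_adj_irr.
pose q v : H := Ordinal (pp_label pp (in_setT v)).
exists H, q; split.
(* Bags are cut off at [n], since [pp_conn] speaks only of nodes below [n]. *)
- pose bagH i : {set H} := if i < n then [set x : 'I_n | val x \in bag i] else set0.
  have bagHE (x : H) i : i < n -> (x \in bagH i) = (val x \in bag i).
    by rewrite /bagH => ->; rewrite inE.
  have ltn_bagH (x : H) i : x \in bagH i -> i < n.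
    by rewrite /bagH; case: ifP => //; rewrite inE.
  apply: (rooted_tw_le (n := n) (par := par) (bag := bagH)); split.
  + exact: (pp_par pp).
  + by move=> i; rewrite leqNgt /bagH => /negbTE ->.
  + by move=> x; exists (val x); rewrite bagHE ?(pp_bag_self pp) // ltn_ord.
  + move=> x y /andP[_ /existsP[i /andP[xi yi]]].
    by exists (val i); rewrite bagHE ?ltn_ord.
  + move=> x i j ij xi xj; have [ltin ltjn] := (ltn_bagH _ _ xi, ltn_bagH _ _ xj).
    move: xi xj; rewrite !bagHE // => [xi xj|]; first exact: (pp_conn pp ij ltjn xi xj).
    exact: leq_ltn_trans (leq_trans (pp_par pp j) (leq_pred j)) ltjn.
  + move=> i; rewrite /bagH; case: ifP => _; last by rewrite cards0.
    apply: leq_trans (pp_bag_size pp i).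
    rewrite cardE -(size_map val); apply: uniq_leq_size.
      by rewrite map_inj_uniq ?enum_uniq //; apply: val_inj.
    by move=> _ /mapP[x + ->]; rewrite mem_enum inE.
- move=> u v uv; have [-> //|ne /=] := eqVneq (q u) (q v).
  have [i [lt ui vi]] := pp_edge pp (in_setT u) (in_setT v) uv.
  by rewrite /quotient_adj ne; apply/existsP; exists (Ordinal lt); rewrite /= ui.
- move=> x; apply: leq_trans (pp_width pp (val x)); apply: subset_leq_card.
  by apply/subsetP=> v; rewrite !inE => /eqP <- /=.
Qed.

End Quotient.

Section Step.
Variables (n0 : nat) (par0 : nat -> nat) (bag0 : nat -> {set G}) (k : nat).
Hypothesis rd : rooted_decomposition n0 par0 bag0 k.
Variables (beta : {set {set G}}) (l d : nat).
Hypothesis beta_cov : lcovering l beta.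
(** [2 * k.+1] bounds the attachments in [closure_small_attachments], so members of [beta] covering
    one attachment have their union in [U]. *)
Let U := unions_upto beta (2 * k.+1).
Hypothesis U_disj : ndisjointed c d U.
(** The size of a closure of [d.+1] vertices, times [l] for the member of [beta] chosen at each of
    its vertices. *)
Let w := l * (d.+1 * d.+1 * k.+1).

(** A new node [n], child of [t], gets as bag its own label and the labels [s a]; its part [P] is
    cut out of [Y]. Around each remaining piece of [Y] one pair [(s i, h i)] is exchanged for [n]
    and a cover of the attachment. *)
Lemma partial_partition_step W p n par bag :
  partial_partition U w W p n par bag -> W != [set: G] ->
  exists (W' : {set G}) p' n' par' bag',
    W \proper W' /\ partial_partition U w W' p' n' par' bag'.
Proof.
move=> pp WT.
have [y yW] : exists y, y \in ~: W.
  by apply/set0Pn; apply: contra WT => /eqP e; rewrite -[W]setCK e setC0.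
have [Y cY yY] := component_of yW.
have [t [s [h [ltn_t st hP hY]]]] := pp_attached pp cY.
have cnY := component_connected cY; have /subsetP sYW := component_sub cY.
pose Bs (i : 'I_c) := h i.
have BU i : Bs i \in U by have [] := hP i (ltn_ord i).
have hnY a v : a < c -> v \in Y -> v \notin h a.
  by case/hP=> _ /disjointFl/[apply] ->.
have [|X cX /subsetP sYX] :=
    connected_in_component (A := ~: \bigcup_(i < c) Bs i) cnY (component_neq0 cY).
  apply/subsetP=> v vY; rewrite inE; apply/bigcupP=> -[i _].
  by apply/negP/hnY.
have [Q [sQX cQ QY]] := U_disj BU cX.
(* Adding [y] makes the new part non-empty, so that [W] grows. *)
have [Z [sQZ cZ ZK]] := closure_small_attachments rd (y |: Q).
have [beta_l beta_T] := beta_cov.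
have excv z : exists2 B, B \in beta & z \in B.
  by have := in_setT z; rewrite -beta_T => /bigcupP[B]; exists B.
have [cv cvb cvz] := fin_all_exists2 excv.
pose hat (A : {set G}) := \bigcup_(z in A) cv z.
have hatU (A : {set G}) : #|A| <= 2 * k.+1 -> hat A \in U.
  move=> cA; apply/unions_uptoP; exists (cv @: A); split.
  - by apply/subsetP=> _ /imsetP[z _ ->].
  - exact: leq_trans (leq_imset_card _ _) cA.
  - apply/setP=> v; apply/bigcupP/bigcupP => [[z zA vz]|[_ /imsetP[z zA ->] vz]].
      by exists (cv z) => //; apply: imset_f.
    by exists z.
have sub_hat (A : {set G}) : A \subset hat A.
  by apply/subsetP=> z zA; apply/bigcupP; exists z.
pose att v := nbh [set x in ~: Z | connect (induced_rel (~: Z)) v x] :&: Z.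
have attE K v : component (~: Z) K -> v \in K -> att v = nbh K :&: Z.
  move=> cK vK; rewrite /att; congr (nbh _ :&: _).
  have vZ := subsetP (component_sub cK) v vK.
  apply: component_eq cK _; first by exists v.
  by apply/set0Pn; exists v; rewrite !inE vK connect0 -in_setC vZ.
(* From each component of [~: Z] only the cover of its own attachment is removed. This makes that
   cover disjoint from the remaining pieces, as [pp_attached] requires, and all of [P] lies in
   [hat Z]. *)
pose P := Y :&: [set v | (v \in Z) || (v \in hat (att v))].
have sPY : P \subset Y by apply: subsetIl.
have PW u : u \in P -> u \notin W.
  by move/(subsetP sPY)/sYW; rewrite inE.
have yP : y \in P by rewrite !inE yY (subsetP sQZ) // !inE eqxx.
have cP : #|P| <= w.
  apply: (@leq_trans #|hat Z|).
    apply/subset_leq_card/subsetP=> v; rewrite !inE => /andP[_ /orP[vZ|]].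
      exact: (subsetP (sub_hat Z)).
    by case/bigcupP=> z /setIP[_ zZ] vz; apply/bigcupP; exists z.
  apply: (@leq_trans (#|Z| * l)).
    rewrite -sum_nat_const /hat; elim/big_rec2: _ => [|z m A _ IH].
      by rewrite cards0.
    by apply: leq_trans (leq_card_setU _ _) _; rewrite leq_add // beta_l.
  rewrite mulnC leq_mul2l; apply/orP; right; apply: leq_trans cZ _.
  have cyQ : #|y |: Q| <= d.+1.
    by rewrite cardsU1 -add1n leq_add // leq_b1.
  by rewrite leq_mul2r leq_mul // orbT.
pose p' u := if u \in P then n else p u.
pose par' j := if j == n then t else par j.
pose bag' j := if j == n then n :: [seq s a | a <- iota 0 c] else bag j.
have bag'n : bag' n = n :: [seq s a | a <- iota 0 c] by rewrite /bag' eqxx.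
have bag'E j : j < n -> bag' j = bag j by rewrite /bag' => /ltn_eqF ->.
have sbag a : a < c -> s a \in bag' n.
  by move=> ac; rewrite bag'n inE map_f ?orbT // mem_iota.
have p'W u : u \in W -> p' u = p u.
  by rewrite /p'; case: ifP => // /PW/negbTE ->.
have p'P u : u \in P -> p' u = n by rewrite /p' => ->.
have Y_nbr u v : u \in Y -> v \in W -> adj u v -> exists2 a, a < c & p v = s a.
  move=> uY vW uv; have [|a [ac _ _ e]] := hY v vW; last by exists a.
  by apply/mem_nbh; exists u.
exists (W :|: P), p', n.+1, par', bag'; split.
  rewrite properUl //; apply/subsetPn; exists y => //.
  by rewrite inE in yW.
split=> //.
- move=> j; rewrite /par'; case: eqP => [->|_]; last exact: (pp_par pp j).
  by rewrite -ltnS prednK // (pp_pos pp).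
- move=> u; rewrite inE => /orP[uW|/p'P -> //].
  by rewrite p'W // ltnS ltnW // (pp_label pp).
- move=> i x; rewrite /bag'; case: eqP => [->|_]; last exact: (pp_bag_le pp).
  rewrite inE => /predU1P[-> //|/mapP[a]]; rewrite mem_iota => /= ac ->.
  exact: leq_trans (pp_bag_le pp (st a ac)) (ltnW ltn_t).
- move=> i; rewrite ltnS leq_eqVlt => /predU1P[->|lt].
    by rewrite bag'n mem_head.
  by rewrite bag'E // (pp_bag_self pp).
- move=> i; rewrite /bag'; case: eqP => [_|_]; last exact: (pp_bag_size pp i).
  by rewrite /= size_map size_iota.
(* Labels in an earlier bag are below [n], so those shared with the new bag are among the [s a],
   which the bag at the parent [t] contains. *)
- move=> x i j ij; rewrite ltnS leq_eqVlt => /predU1P[ej|ltj].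
    subst j; rewrite (bag'E _ ij) bag'n /par' eqxx (bag'E _ ltn_t) => xi.
    rewrite inE => /predU1P[ex|/mapP[a]].
      by have := pp_bag_le pp xi; rewrite ex leqNgt ij.
    by rewrite mem_iota => /= ac ->; apply: st.
  rewrite /par' (ltn_eqF ltj) !bag'E //; last exact: ltn_trans ij ltj.
    exact: (pp_conn pp ij ltj).
  exact: leq_ltn_trans (leq_trans (pp_par pp j) (leq_pred j)) ltj.
- have cross u v : u \in P -> v \in W -> adj u v ->
      exists i, [/\ i < n.+1, p' u \in bag' i & p' v \in bag' i].
    move=> uP vW uv; exists n; rewrite p'P // p'W //.
    have [a ac ->] := Y_nbr u v (subsetP sPY u uP) vW uv.
    by rewrite sbag // bag'n mem_head.
  move=> u v /setUP[uW|uP] /setUP[vW|vP] uv.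
  + have [i [lt ui vi]] := pp_edge pp uW vW uv; exists i.
    by rewrite !p'W // bag'E // ltnS ltnW.
  + rewrite adj_sym in uv; have [i [lt vi ui]] := cross v u vP uW uv.
    by exists i.
  + exact: cross.
  + by exists n; rewrite !p'P // bag'n mem_head.
- move=> x; have [->|ne] := eqVneq x n.
    apply: leq_trans cP; apply/subset_leq_card/subsetP=> u.
    rewrite inE [u \in _ :|: _]inE.
    case: (boolP (u \in P)) => // uP; rewrite orbF => /andP[uW].
    by rewrite p'W // => /eqP e; have := pp_label pp uW; rewrite e ltnn.
  apply: leq_trans (pp_width pp x); apply/subset_leq_card/subsetP=> u.
  rewrite inE [u \in _ :|: _]inE => /andP[/orP[uW|/p'P ->]].
    by rewrite p'W // => pu; rewrite inE uW.
  by rewrite eq_sym (negbTE ne).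
move=> Y' cY'.
have cnY' := component_connected cY'.
have sY'W : Y' \subset ~: W.
  by apply: subset_trans (component_sub cY') _; rewrite setCS subsetUl.
(* A component disjoint from [Y] is an old one and keeps its data: no vertex of [P] is adjacent to
   it. *)
have [Y'Y|Y'Y] := eqVneq (Y :&: Y') set0.
  have [Y2 cY2 sY'2] := connected_in_component cnY' (component_neq0 cY') sY'W.
  have Y2Y : Y2 :&: Y = set0.
    apply/eqP/negP=> /negP ne; case/set0Pn: (component_neq0 cY') => v vY'.
    have := subsetP sY'2 v vY'; rewrite (component_eq cY2 cY ne) => vY.
    by move/setP/(_ v): Y'Y; rewrite !inE vY vY'.
  have e : Y' = Y2.
    apply/eqP; rewrite eqEsubset sY'2; apply: (component_absorb cY').
    - exact: component_connected cY2.
    - apply/subsetP=> v vY2; rewrite in_setC in_setU negb_or -in_setC.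
      rewrite (subsetP (component_sub cY2)) //=; apply/negP=> vP.
      by move/setP/(_ v): Y2Y; rewrite inE vY2 (subsetP sPY) // inE.
    - have /set0Pn[v vY'] := component_neq0 cY'.
      by apply/set0Pn; exists v; rewrite inE vY' (subsetP sY'2).
  have [t2 [s2 [h2 [lt2 st2 hP2 hY2]]]] := pp_attached pp cY2.
  exists t2, s2, h2; rewrite e; split=> //; first exact: ltnW.
    by move=> a ac; rewrite bag'E // st2.
  move=> u; rewrite inE => /orP[uW uY2|uP]; first by rewrite p'W //; apply: hY2.
  case/mem_nbh=> v vY2 vu; have uY := subsetP sPY u uP.
  have := component_closed cY2 vY2 (sYW u uY) vu => uY2.
  by move/setP/(_ u): Y2Y; rewrite !inE uY uY2.
have /subsetP sY'Y : Y' \subset Y by apply: component_absorb cY cnY' sY'W Y'Y.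
have Y'P v : v \in Y' -> v \notin P.
  move=> /(subsetP (component_sub cY')).
  by rewrite in_setC in_setU negb_or => /andP[].
have Y'Z v : v \in Y' -> v \notin Z.
  by move=> vY'; apply: contra (Y'P v vY') => vZ; rewrite !inE sY'Y // vZ.
have [|K cK /subsetP sY'K] := connected_in_component
    (A := ~: Z) cnY' (component_neq0 cY').
  by apply/subsetP=> v vY'; rewrite inE Y'Z.
have [|Y2 cY2 /subsetP sY'2] := connected_in_component
    (A := X :\: Q) cnY' (component_neq0 cY').
  apply/subsetP=> v vY'; rewrite inE sYX ?sY'Y // andbT.
  apply: contra (Y'Z v vY') => vQ; apply: (subsetP sQZ).
  by rewrite inE vQ orbT.
have [i Y2i] := QY Y2 cY2.
have c0 : 0 < c := leq_ltn_trans (leq0n i) (ltn_ord i).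
have bump_lt b : b < c.-1 -> bump i b < c.
  move=> bc; apply: leq_ltn_trans (leq_add (leq_b1 _) (leqnn b)) _.
  by rewrite add1n -ltn_predRL.
(* [bump i] skips the index [i], and the new pair takes the last place [c.-1]. There it does not
   disturb which set is the first to contain an old vertex. *)
pose s' b := if b < c.-1 then s (bump i b) else n.
pose h' b := if b < c.-1 then h (bump i b) else hat (nbh K :&: Z).
exists n, s', h'; split=> //.
- move=> b bc; rewrite /s'; case: ifP => [/bump_lt/sbag //|_].
  by rewrite bag'n mem_head.
- move=> b bc; rewrite /h'; case: ifP => [/bump_lt lt|_].
    have [hU hd] := hP _ lt; split=> //.
    by apply: disjointWr hd; apply/subsetP.
  split; first by apply/hatU/ZK.
  rewrite disjoint_sym disjoints_subset; apply/subsetP=> v vY'.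
  rewrite inE; apply: contra (Y'P v vY') => vh.
  by rewrite !inE sY'Y // (attE K) ?vh ?orbT // sY'K.
move=> u uW' /mem_nbh[v vY' vu].
(* A vertex of [P] lies in no old set, as these avoid [Y], so the new last set is the first to
   contain it. *)
have [uP|uP] := boolP (u \in P).
  have uY := subsetP sPY u uP.
  exists c.-1; rewrite prednK // leqnn /h' /s' ltnn p'P //; split=> //.
    have [uZ|uZ] := boolP (u \in Z).
      apply: (subsetP (sub_hat _)); rewrite inE uZ andbT.
      by apply/mem_nbh; exists v; rewrite // sY'K.
    have uK : u \in K by apply: component_closed cK (sY'K v vY') _ vu; rewrite inE.
    by move: uP; rewrite !inE (negbTE uZ) (attE K) // => /andP[].
  by move=> b bc; rewrite bc hnY // bump_lt.
have uW : u \in W by move: uW'; rewrite inE (negbTE uP) orbF.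
have [|a [ac ua una pu]] := hY u uW; first by apply/mem_nbh; exists v; rewrite ?sY'Y.
(* [u] is in [h a] and in no earlier set, so [a = i] would make [u] a neighbour that [Y2] has to
   miss. *)
have ai : a \in predC1 (val i).
  rewrite inE; apply/eqP=> e; subst a.
  move/setP/(_ v): Y2i; rewrite !inE sY'2 //=; case/existsP; exists u.
  rewrite [adj u v]adj_sym vu andbT inE ua andbT.
  by apply/bigcupP=> -[j ji]; apply/negP/una.
have ub : unbump i a < c.-1.
  move: ai; rewrite inE /unbump => ai; case: (ltngtP i a) ai => // [ia _|ai _].
    by rewrite subn1 -ltnS !prednK // (leq_ltn_trans _ ia).
  by rewrite subn0 -ltnS prednK //; apply: leq_ltn_trans ai (ltn_ord i).
exists (unbump i a); rewrite /h' /s' ub unbumpK // p'W //; split=> //.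
  by apply: leq_trans ub (leq_pred c).
move=> b lt; rewrite (ltn_trans lt ub); apply: una.
by rewrite -(unbumpK ai) ltnNge leq_bump2 -ltnNge.
Qed.

Lemma tpw_le_of_disjointed : tpw_le c G w.
Proof.
have U0 : set0 \in U.
  by apply/unions_uptoP; exists set0; rewrite sub0set cards0 big_set0.
have complete m W p n par bag : #|~: W| = m ->
    partial_partition U w W p n par bag ->
    exists p' n' par' bag', partial_partition U w [set: G] p' n' par' bag'.
  elim/ltn_ind: m W p n par bag => m IH W p n par bag em pp.
  have [e|ne] := eqVneq W [set: G]; first by subst W; exists p, n, par, bag.
  have [W' [p' [n' [par' [bag' [lt pp']]]]]] := partial_partition_step pp ne.
  apply: (IH #|~: W'| _ W' p' n' par' bag' erefl pp').
  by rewrite -em; apply: proper_card; rewrite properC.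
have [p [n [par [bag pp]]]] := complete _ _ _ _ _ _ erefl (partial_partition0 w U0).
exact: partial_partition_tpw_le pp.
Qed.

End Step.

End TreePartition.

(** * Partitions into fibres *)

Lemma lpartition_fibres (G H : sgraph) (p : G -> H) w :
  part_width_le p w -> lpartition w [set p @^-1: [set x] | x in p @: [set: G]].
Proof.
move=> pw; split; first split.
- move=> _ /imsetP[x _ ->]; rewrite (_ : p @^-1: _ = [set v | p v == x]) //.
  by apply/setP=> v; rewrite !inE.
- apply/setP=> v; rewrite inE; apply/bigcupP.
  by exists (p @^-1: [set p v]); rewrite ?inE // !imset_f.
- move=> _ _ /imsetP[x _ ->] /imsetP[y _ ->] ne.
  rewrite -setI_eq0; apply/eqP/setP=> v; rewrite !inE.
  by apply/negP=> /andP[/eqP ex /eqP ey]; rewrite -ex -ey eqxx in ne.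
Qed.

(** Preimages commute with unions, and choosing one [B] for each member does not increase their
    number. *)
Lemma unions_upto_preimset (G H : sgraph) (p : G -> H) (gamma : {set {set H}}) t :
  unions_upto [set p @^-1: B | B : {set H} in gamma] t \subset
  [set p @^-1: B | B : {set H} in unions_upto gamma t].
Proof.
apply/subsetP=> _ /unions_uptoP[S [/subsetP Sf St ->]].
have exB (A : {set G}) : exists B, A \in S -> B \in gamma /\ A = p @^-1: B.
  by have [/Sf/imsetP[B gB ->]|] := boolP (A \in S); [exists B|exists set0].
have [F FP] := fin_all_exists exB.
apply/imsetP; exists (\bigcup_(B in F @: S) B).
  apply/unions_uptoP; exists (F @: S); split=> //.
    by apply/subsetP=> _ /imsetP[A AS ->]; have [] := FP A AS.
  exact: leq_trans (leq_imset_card _ _) St.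
apply/setP=> v; rewrite inE; apply/bigcupP/bigcupP => [[A AS vA]|].
  exists (F A); first exact: imset_f.
  by have [_ e] := FP A AS; move: vA; rewrite {1}e inE.
case=> _ /imsetP[A AS ->] vF; exists A => //.
by have [_ ->] := FP A AS; rewrite inE.
Qed.

(** The factors of the bound come from singletons ([c.+1]), unions ([t ^ c]) and the pullback ([w]);
    the successor makes it positive. *)
Lemma lpartition_of_tpw_le (G : sgraph) c w : tpw_le c G w ->
  exists beta : {set {set G}}, lpartition w beta /\
    f_disjointed c (fun t => INR (w * (t ^ c * c.+1)).+1) beta.
Proof.
case=> H [p [/tw_le_rooted[n [par [bag rd]]] pP pw]].
exists [set p @^-1: [set x] | x in p @: [set: G]].
split; first exact: lpartition_fibres.
move=> t _; pose sing := [set [set x] | x in p @: [set: G]] : {set {set H}}.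
have -> : [set p @^-1: [set x] | x in p @: [set: G]] =
    [set p @^-1: B | B : {set H} in sing].
  apply/setP=> A; apply/imsetP/imsetP => [[x xp ->]|[_ /imsetP[x xp ->] ->]].
    by exists [set x]; rewrite ?imset_f.
  by exists x.
apply: disjointed_sub (unions_upto_preimset p sing t) _.
have sing_disj : ndisjointed c c.+1 sing.
  move=> Bs bBs; apply: (ndisjointed_singletons rd) => i.
  by case/imsetP: (bBs i) => x _ ->; apply: imset_f.
have dj := ndisjointed_preimset pP pw (ndisjointed_unions_upto (t := t) sing_disj).
move=> Bs bBs X cX; have [Q [sQ cQ QY]] := ndisjointedP dj bBs cX.
by exists Q; split=> //; apply: Rle_trans cQ _; apply/le_INR/leP.
Qed.

(** * Bounds and the equivalence *)

Lemma INR_ub (r : R) : exists2 d, 0 < d & Rle r (INR d).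
Proof.
have [d dP] := INR_unbounded r; exists d.+1 => //.
by apply: Rle_trans (Rlt_le _ _ dP) _; apply/le_INR/leP.
Qed.

(** Passing to unions of [2 * k.+1] members replaces [d] by [(2 * k.+1) ^ c * d] in the width of the
    construction. *)
Lemma tpw_le_of_lcovering (G : sgraph) k c d l (beta : {set {set G}}) :
  tw_le G k -> lcovering l beta -> disjointed c (INR d) beta ->
  tpw_le c G (l * (((2 * k.+1) ^ c * d).+1 * ((2 * k.+1) ^ c * d).+1 * k.+1)).
Proof.
move=> /tw_le_rooted[n [par [bag rd]]] cov /(disjointed_ub (Rle_refl _)) dj.
exact: (tpw_le_of_disjointed rd cov (ndisjointed_unions_upto dj)).
Qed.

Lemma disjointed_of_f_disjointed (G : sgraph) c (f : nat -> R) d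
    (beta : {set {set G}}) :
  Rle (f 1) (INR d) -> f_disjointed c f beta -> disjointed c (INR d) beta.
Proof.
move=> fd /(_ 1 isT) /(disjointed_sub (sub_unions_upto beta (ltn0Sn 0))).
by move/(disjointed_ub fd)/ndisjointedP.
Qed.

Theorem theorem3p2 (c : nat) (C : sgraph -> Prop) :
  iso_closed C ->
  (exists k, forall G, C G -> tw_le G k) ->
  let a := exists w, forall G, C G -> tpw_le c G w in
  let b := exists d l, [/\ 0 < d, 0 < l & forall G, C G ->
             exists beta : {set {set G}}, lpartition l beta /\ disjointed c (INR d) beta] in
  let cc := exists d l, [/\ 0 < d, 0 < l & forall G, C G ->
             exists beta : {set {set G}}, lcovering l beta /\ disjointed c (INR d) beta] in
  let dd := exists l (f : nat -> R), [/\ 0 < l, pos_fun f & forall G, C G ->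
             exists beta : {set {set G}}, lpartition l beta /\ f_disjointed c f beta] in
  let e := exists l (f : nat -> R), [/\ 0 < l, pos_fun f & forall G, C G ->
             exists beta : {set {set G}}, lcovering l beta /\ f_disjointed c f beta] in
  [/\ a <-> b, a <-> cc, a <-> dd & a <-> e].
Proof.
move=> _ [k twk] a b cc dd e.
(* The implications form the cycle [a], [dd], [b], [cc], [a], with a second way from [dd] to [cc]
   through [e]. *)
have a_dd : a -> dd.
  (* [w.+1] is taken because [l] has to be positive, while [w] may be [0]. *)
  case=> w aw; exists w.+1, (fun t => INR (w.+1 * (t ^ c * c.+1)).+1).
  split=> // [t _|G CG]; first exact/lt_0_INR/ltP.
  have [H [p [twH pP pw]]] := aw G CG; apply: lpartition_of_tpw_le.
  by exists H, p; split=> // x; apply: leqW.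
have dd_b : dd -> b.
  case=> l [f [l0 _ ddP]]; have [d d0 fd] := INR_ub (f 1).
  exists d, l; split=> // G /ddP[beta [lb fb]].
  by exists beta; split=> //; apply: disjointed_of_f_disjointed fb.
have dd_e : dd -> e.
  case=> l [f [l0 f0 ddP]]; exists l, f; split=> // G /ddP[beta [[lb _] fb]].
  by exists beta.
have b_cc : b -> cc.
  case=> d [l [d0 l0 bP]]; exists d, l; split=> // G /bP[beta [[lb _] db]].
  by exists beta.
have e_cc : e -> cc.
  case=> l [f [l0 _ eP]]; have [d d0 fd] := INR_ub (f 1).
  exists d, l; split=> // G /eP[beta [lb fb]].
  by exists beta; split=> //; apply: disjointed_of_f_disjointed fb.
have cc_a : cc -> a.
  case=> d [l [_ _ ccP]].
  exists (l * (((2 * k.+1) ^ c * d).+1 * ((2 * k.+1) ^ c * d).+1 * k.+1)).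
  move=> G CG; have [beta [lb db]] := ccP G CG.
  by apply: tpw_le_of_lcovering (twk G CG) lb db.
by split; tauto.
Qed.
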